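(* Let $\mathcal{C}\subset\mathbb{R}^n$ be a full-dimensional compact convex set satisfying the $\delta$-scaling inequality, let $s\in(1,2]$, and let $f:\mathbb{R}^n\to\mathbb{R}$ be an $(L,s)$-Hölder smooth convex function with Hölder away curvature $C_{f,s}^A$, satisfying the $(\theta,c)$-Hölderian error bound on $\mathcal{C}$. Let $\gamma>0$ and let $x_0\in\mathcal{C}$, with proper support $\mathcal{S}_0$, be such that $e^{-\gamma}w(x_0,\mathcal{S}_0)/2\le C_{f,s}^A$. Run the scheduled restart scheme for the Fractional Away-step Frank-Wolfe algorithm from $(x_0,\mathcal{S}_0)$ with $\gamma_k=\gamma$, and let $x_T$, with support $\mathcal{S}_T$, be the output after $T$ cumulative inner iterations. Set $r=\frac{1}{1-\theta}$, $w_0=w(x_0,\mathcal{S}_0)$, $\tilde T=T-(|\mathcal{S}_0|-|\mathcal{S}_T|)$, $\tau=\frac{s}{s-1}-r$, and $f^*=\min_{\mathcal{C}}f$. Then, when $1\le r<\frac{s}{s-1}$, $$f(x_T)-f^*\le w_0\,\frac{1}{\big(1+\tilde T\,C_\gamma^\tau\big)^{\frac1\tau}},\qquad C_\gamma^\tau=\frac{e^{\gamma\tau}-1}{C_s\,e^{\frac{s}{s-1}\gamma}\,w(x_0,\mathcal{S}_0)^{-\tau}},$$ with $C_s=2^{1+\frac{s}{s-1}}\,\frac{s}{s-1}\,\big(\frac{c}{\delta}\big)^{r}\,\big(C_{f,s}^A\big)^{\frac{1}{s-1}}$.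
   Context: $\|\cdot\|$ is a fixed norm on $\mathbb{R}^n$; $X^*=\operatorname{argmin}_{\mathcal{C}}f$. A differentiable $f$ is $(L,s)$-Hölder smooth on $\mathcal{C}$ if $\|\nabla f(x)-\nabla f(y)\|_2\le L\|x-y\|_2^{s-1}$ for $x,y\in\mathcal{C}$. Hölder away curvature: $C_{f,s}^A=\sup\frac{s}{\eta^s}\big(f(y)-f(x)-\eta\langle\nabla f(x),u-v\rangle\big)$ over $x,u,v\in\mathcal{C}$, $\eta\in(0,1]$, $y=x+\eta(u-v)$. $\operatorname{Ext}(\mathcal{C})$ is the set of extreme points. A finite $\mathcal{S}\subset\operatorname{Ext}(\mathcal{C})$ is a proper support of $x\in\mathcal{C}$ if $x$ is a convex combination of the elements of $\mathcal{S}$ with all weights positive; $\mathcal{S}_x$ is the set of proper supports of $x$. Define $w(x,\mathcal{S})=\max_{y\in\mathcal{S},z\in\mathcal{C}}\nabla f(x)^T(y-z)$ for $\mathcal{S}\in\mathcal{S}_x$, and $w(x)=\min_{\mathcal{S}\in\mathcal{S}_x}w(x,\mathcal{S})$ (infimum if not attained). $\delta$-scaling ($\delta>0$): for every differentiable convex $f$ (with its $X^*$ and $w$) and every $x\in\mathcal{C}\setminus X^*$, $w(x)\ge\delta\max_{x^*\in X^*}\langle\nabla f(x),\frac{x-x^*}{\|x-x^*\|}\rangle$. $(\theta,c)$-Hölderian error bound on $\mathcal{C}$ ($\theta\in[0,1/2]$, $c>0$): $\min_{x^*\in X^*}\|x-x^*\|\le c(f(x)-f^* )^\theta$ for all $x\in\mathcal{C}$.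 Fractional Away-step Frank-Wolfe algorithm. Input: $\gamma>0$, $x_0=\sum_{v\in\mathcal{S}_0}\alpha_0^v v$ with proper support $\mathcal{S}_0$ and positive weights $\alpha_0^v$. Set $t=0$. While $w(x_t,\mathcal{S}_t)>e^{-\gamma}w(x_0,\mathcal{S}_0)$: take an extreme point $v_t\in\operatorname{argmin}_{v\in\mathcal{C}}\nabla f(x_t)^Tv$, $d_t^{FW}=v_t-x_t$; take $s_t\in\operatorname{argmax}_{v\in\mathcal{S}_t}\nabla f(x_t)^Tv$, $d_t^{Away}=x_t-s_t$. If $-\nabla f(x_t)^Td_t^{FW}>e^{-\gamma}w(x_0,\mathcal{S}_0)/2$, set $d_t=d_t^{FW}$, $\eta_{\max}=1$; otherwise $d_t=d_t^{Away}$, $\eta_{\max}=\alpha_t^{s_t}/(1-\alpha_t^{s_t})$. Set $x_{t+1}=x_t+\eta_td_t$ with $\eta_t\in\operatorname{argmin}_{\eta\in[0,\eta_{\max}]}f(x_t+\eta d_t)$ (exact line search). Update: for a Frank-Wolfe step, multiply all weights by $1-\eta_t$, add $\eta_t$ to the weight of $v_t$, and set $\mathcal{S}_{t+1}=\{v_t\}$ if $\eta_t=1$, else $\mathcal{S}_t\cup\{v_t\}$; for an away step, multiply all weights by $1+\eta_t$, subtract $\eta_t$ from the weight of $s_t$, and set $\mathcal{S}_{t+1}=\mathcal{S}_t\setminus\{s_t\}$ if $\eta_t=\eta_{\max}$, else $\mathcal{S}_t$. Then $t\leftarrow t+1$. Output: the first iterate with $w(x_t,\mathcal{S}_t)\le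 e^{-\gamma}w(x_0,\mathcal{S}_0)$, with its support and weights. Scheduled restarts: given $\epsilon>0$, an iteration budget and parameters $(\gamma_k)$, repeatedly run the Fractional Away-step Frank-Wolfe algorithm to completion, the $k$-th run using parameter $\gamma_k$ and starting from the iterate, support and weights output by run $k-1$ (the first run starting from $x_0,\mathcal{S}_0$), as long as the strong Wolfe gap $w(\cdot,\cdot)$ of the current point exceeds $\epsilon$ and the cumulative number of iterations is below the budget. Output: the output of the last run.
   Formalization: The bound is asserted only when 1 + T̃ C_γ^τ > 0; T̃ can be very negative when a Frank-Wolfe step with η = 1 collapses a large support, and then the right-hand side is undefined or even negative. *)

(* Defs.v *)
(* MathComp-Analysis; the algorithm is a nondeterministic transition relation,
   so a theorem about it covers every choice of the argmin/argmax elements. *)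
From mathcomp Require Export all_boot all_order all_algebra finmap.
From mathcomp Require Export all_classical all_reals all_analysis.
Export Order.TTheory GRing.Theory Num.Theory.
Export numFieldNormedType.Exports.

Set Implicit Arguments.
Unset Strict Implicit.
Unset Printing Implicit Defensive.

Local Open Scope classical_set_scope.
Local Open Scope ring_scope.

Definition argmin {T : Type} {R : realType} (A : set T) (F : T -> R) : set T :=
  [set a | A a /\ forall b, A b -> F a <= F b].

Definition argmax {T : Type} {R : realType} (A : set T) (F : T -> R) : set T :=
  [set a | A a /\ forall b, A b -> F b <= F a].

Definition dot {R : realType} {n : nat} (x y : 'rV[R]_n) : R :=
  \sum_(i < n) x 0 i * y 0 i.

Definition norm2 {R : realType} {n : nat} (x : 'rV[R]_n) : R :=
  Num.sqrt (dot x x).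

Definition grad {R : realType} {n : nat} (f : 'rV[R]_n -> R) (x : 'rV[R]_n) :
    'rV[R]_n :=
  \row_(i < n) 'D_(delta_mx 0 i) f x.

(* The library norm on ['rV[R]_n] is the sup norm; it is used here only through
   the topology (compactness, interior, differentiability), which in finite
   dimension does not depend on the norm. *)
Definition is_norm {R : realType} {n : nat} (N : 'rV[R]_n -> R) : Prop :=
  [/\ forall x, 0 <= N x,
      forall x, N x = 0 -> x = 0,
      forall (a : R) x, N (a *: x) = `|a| * N x
    & forall x y, N (x + y) <= N x + N y].

Section problem.
Variables (R : realType) (n : nat).
Local Notation V := 'rV[R]_n.
Implicit Types (C : set V) (f : V -> R) (N : V -> R) (x : V) (S : {fset V}).

Definition full_dimensional C : Prop := interior C !=set0.

Definition differentiable_everywhere f : Prop := forall x, differentiable f x.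

Definition convex_everywhere f : Prop := @convex_function R V setT f.

Definition minimizers C f : set V := argmin C f.

(* This infimum is a minimum when [C] is compact and nonempty and [f] is
   continuous. *)
Definition min_value C f : R := inf [set f x | x in C].

Definition holder_smooth C f (L s : R) : Prop :=
  differentiable_everywhere f /\
  forall x y, C x -> C y ->
    norm2 (grad f x - grad f y) <= L * norm2 (x - y) `^ (s - 1).

(* The point [y = x + eta (u - v)] may lie outside [C]. Without a regularity
   assumption on [f] outside [C] the supremum may be [+oo], hence its type. *)
Definition holder_away_curvature C f (s : R) : \bar R :=
  ereal_sup [set q : \bar R | exists x u v (eta : R),
    [/\ C x, C u, C v, 0 < eta <= 1 &
     q = (s / eta `^ s *
          (f (x + eta *: (u - v)) - f x - eta * dot (grad f x) (u - v)))%:E]].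

Definition extreme_point C : set V :=
  [set x | C x /\ forall y z (t : R), C y -> C z -> 0 < t < 1 ->
     x = t *: y + (1 - t) *: z -> y = z].

Definition proper_decomposition C x S (alpha : V -> R) : Prop :=
  [/\ forall v, v \in S -> extreme_point C v,
      forall v, v \in S -> 0 < alpha v,
      \sum_(v <- S) alpha v = 1
    & x = \sum_(v <- S) alpha v *: v].

Definition proper_support C x S : Prop :=
  exists alpha, proper_decomposition C x S alpha.

(* The strong Wolfe gap [w(x, S)]; the supremum is a maximum when [S] is
   nonempty and [C] is compact and nonempty. *)
Definition wolfe_gap C f x S : R :=
  sup [set q : R | exists y z,
         [/\ y \in S, C z & q = dot (grad f x) (y - z)]].

Definition min_wolfe_gap C f x : R :=
  inf [set wolfe_gap C f x S | S in proper_support C x].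

Definition delta_scaling C N (delta : R) : Prop :=
  forall f, differentiable_everywhere f -> convex_everywhere f ->
  forall x, C x -> ~ minimizers C f x ->
    delta * sup [set dot (grad f x) ((N (x - xs))^-1 *: (x - xs))
                | xs in minimizers C f]
      <= min_wolfe_gap C f x.

(* [0 `^ 0 = 1], so for [theta = 0] the bound reads [dist <= c] everywhere. *)
Definition holderian_error_bound C N f (theta c : R) : Prop :=
  forall x, C x ->
    inf [set N (x - xs) | xs in minimizers C f]
      <= c * (f x - min_value C f) `^ theta.

Record fw_state := FWState {
  iterate : V;
  support : {fset V};
  weight : V -> R }.

Definition gap C f (st : fw_state) : R :=
  wolfe_gap C f (iterate st) (support st).

(* A vertex outside the current support has weight 0, whatever value the total
   function [weight st] takes there. *)
Definition cur_weight (st : fw_state) (u : V) : R :=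
  if u \in support st then weight st u else 0.

Definition fw_update (st : fw_state) (v : V) (eta : R) : fw_state :=
  FWState (iterate st + eta *: (v - iterate st))
          (if eta == 1 then [fset v]%fset else (v |` support st)%fset)
          (fun u => (1 - eta) * cur_weight st u + eta * (u == v)%:R).

Definition away_update (st : fw_state) (s : V) (eta eta_max : R) : fw_state :=
  FWState (iterate st + eta *: (iterate st - s))
          (if eta == eta_max then (support st `\ s)%fset else support st)
          (fun u => (1 + eta) * cur_weight st u - eta * (u == s)%:R).

(* [thr] stands for [e^(-gamma) w(x_0, S_0)], fixed during a run. In the away
   case [cur_weight st s < 1]: with a single vertex in the support the
   Frank-Wolfe gap equals the strong Wolfe gap, so the other case applies. *)
Definition fafw_step C f (thr : R) (st st' : fw_state) : Prop :=
  exists v s (eta : R),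
  let x := iterate st in
  [/\ extreme_point C v,
      argmin C (dot (grad f x)) v,
      argmax [set u | u \in support st] (dot (grad f x)) s
    & if thr / 2 < - dot (grad f x) (v - x) then
        argmin [set e | 0 <= e <= 1] (fun e => f (x + e *: (v - x))) eta /\
        st' = fw_update st v eta
      else
        let eta_max := cur_weight st s / (1 - cur_weight st s) in
        argmin [set e | 0 <= e <= eta_max] (fun e => f (x + e *: (x - s))) eta /\
        st' = away_update st s eta eta_max].

Inductive fafw_loop C f (thr : R) : nat -> fw_state -> fw_state -> Prop :=
| fafw_stop st : gap C f st <= thr -> fafw_loop C f thr 0 st st
| fafw_iter t st st' st'' :
    thr < gap C f st -> fafw_step C f thr st st' ->
    fafw_loop C f thr t st' st'' -> fafw_loop C f thr t.+1 st st''.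

(* [fafw gamma t st st']: the algorithm started at [st] performs exactly [t]
   iterations and outputs [st']. *)
Definition fafw C f (gamma : R) (t : nat) (st st' : fw_state) : Prop :=
  fafw_loop C f (expR (- gamma) * gap C f st) t st st'.

(* [restart_runs k T st]: after [k] runs and [T] cumulative inner iterations
   the current point is [st]; runs are numbered from 1. *)
Inductive restart_runs C f (eps : R) (budget : nat) (gamma_ : nat -> R)
    (st0 : fw_state) : nat -> nat -> fw_state -> Prop :=
| restart_init : restart_runs C f eps budget gamma_ st0 0 0 st0
| restart_next k T t st st' :
    restart_runs C f eps budget gamma_ st0 k T st ->
    eps < gap C f st -> (T < budget)%N ->
    fafw C f (gamma_ k.+1) t st st' ->
    restart_runs C f eps budget gamma_ st0 k.+1 (T + t)%N st'.

Definition restart_output C f (eps : R) (budget : nat) (gamma_ : nat -> R)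
    (st0 : fw_state) (T : nat) (st : fw_state) : Prop :=
  (exists k, restart_runs C f eps budget gamma_ st0 k T st) /\
  ~ (eps < gap C f st /\ (T < budget)%N).

End problem.

(* Main.v *)
Require Import Defs.
From mathcomp Require Import ring lra.
Set Implicit Arguments.
Unset Strict Implicit.
Unset Printing Implicit Defensive.
Local Open Scope classical_set_scope.
Local Open Scope ring_scope.

(** Write [p = s / (s - 1)] and let [w] be the strong Wolfe gap at the start of a
    run, whose steps then work against the threshold [exp (- gamma) * w]. The
    gap is the sum of the slopes of the Frank-Wolfe and the away directions, so
    the direction chosen has slope at least [h = exp (- gamma) * w / 2], and the
    away curvature turns this into a decrease of [f] of order [h `^ p], unless
    the line search of an away step stops where the weight of its vertex
    vanishes. Such a drop step removes a vertex, which an earlier step added or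
    which was in the initial support. Hence at least half of the iterations,
    corrected by the net change of the support, achieve the full decrease
    ([fafw_stepP], [fafw_loopP]).

    These decreases add up to at most the suboptimality at the start of the run.
    By convexity the suboptimality is at most the slope of [f] towards any
    minimizer, which the scaling inequality bounds by the gap times the distance
    to that minimizer; the error bound controls the distance by a power of the
    suboptimality itself. Solving this gives the bound [(c / delta * w) `^ r]
    ([suboptimality_le_gap_powR]). The corrected length of the run is therefore
    at most a constant times [w `^ (r - p) = w `^ (- tau)] ([fafw_count]).

    A run multiplies the gap by at most [exp (- gamma)], so it multiplies
    [w `^ (- tau)] by at least [exp (gamma * tau)], and its corrected length is
    bounded by the increase of [w `^ (- tau)]. In this form the bounds of
    successive runs telescope ([restart_runsP]). Solving for the final gap
    yields the rate, because the gap dominates the suboptimality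
    ([suboptimality_le_gap]). *)

(** * The dot product and the gradient *)

Section dot_product.
Variables (R : realType) (n : nat).
Local Notation V := 'rV[R]_n.
Implicit Types (g x y : V).

Lemma dotDr g x y : dot g (x + y) = dot g x + dot g y.
Proof. by rewrite /dot -big_split; apply: eq_bigr => i _; rewrite !mxE mulrDr. Qed.

Lemma dotZr g (a : R) x : dot g (a *: x) = a * dot g x.
Proof. by rewrite /dot mulr_sumr; apply: eq_bigr => i _; rewrite !mxE mulrCA. Qed.

Lemma dotBr g x y : dot g (x - y) = dot g x - dot g y.
Proof. by rewrite dotDr -scaleN1r dotZr mulN1r. Qed.

Lemma dot_sumr g (s : seq V) (a : V -> R) :
  dot g (\sum_(v <- s) a v *: v) = \sum_(v <- s) a v * dot g v.
Proof.
elim: s => [|v s IHs]; last by rewrite !big_cons dotDr dotZr IHs.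
by rewrite !big_nil /dot big1 // => i _; rewrite mxE mulr0.
Qed.

Lemma coord_le_supnorm x (i : 'I_n) : `|x 0 i| <= `|x|.
Proof.
rewrite [leRHS]/Num.norm /= mx_normrE.
exact: (le_bigmax _ (fun ij => `|x ij.1 ij.2|) (0, i)).
Qed.

Lemma dot_bounded g (A : set V) : bounded_set A ->
  exists M : R, forall x, A x -> `|dot g x| <= M.
Proof.
move=> [K [_ HK]]; exists (\sum_(i < n) `|g 0 i| * (K + 1)) => x Ax.
rewrite (le_trans (ler_norm_sum _ _ _)) //; apply: ler_sum => i _.
rewrite normrM ler_wpM2l //.
by apply: le_trans (coord_le_supnorm x i) _; apply: HK => //; rewrite ltrDl.
Qed.

Lemma derive_dot_grad (f : V -> R) x v :
  differentiable f x -> 'D_v f x = dot (grad f x) v.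
Proof.
move=> df; rewrite deriveE // [in LHS](row_sum_delta v) linear_sum.
apply: eq_bigr => i _; rewrite linearZ /= mxE deriveE //.
by rewrite mulrC.
Qed.

End dot_product.

(** * Convexity *)

Section convexity.
Variables (R : realType) (n : nat).
Local Notation V := 'rV[R]_n.
Implicit Types (f : V -> R) (C : set V) (x y : V).

Lemma convex_everywhereE f x y (t : R) : convex_everywhere f -> 0 <= t <= 1 ->
  f (t *: x + (1 - t) *: y) <= t * f x + (1 - t) * f y.
Proof.
move=> cf /andP[t0 t1].
have tI : Itv.spec (@Itv.num_sem R) (Itv.Real `[0%Z, 1%Z]) t.
  by rewrite /Itv.num_sem/= in_itv/= realE t0 t1.
by have := cf (Itv.mk tI) x y (mem_setT _) (mem_setT _).
Qed.

Lemma convex_setE C x y (t : R) : @convex_set R V C -> C x -> C y ->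
  0 <= t <= 1 -> C (t *: x + (1 - t) *: y).
Proof.
move=> cC Cx Cy /andP[t0 t1].
have tI : Itv.spec (@Itv.num_sem R) (Itv.Real `[0%Z, 1%Z]) t.
  by rewrite /Itv.num_sem/= in_itv/= realE t0 t1.
by have := cC x y (Itv.mk tI) (mem_set Cx) (mem_set Cy); rewrite inE.
Qed.

Lemma convex_grad_le f x y : differentiable f x -> convex_everywhere f ->
  dot (grad f x) (y - x) <= f y - f x.
Proof.
move=> df cf; rewrite -derive_dot_grad //.
have /cvg_ex[l fl] := diff_derivable (v := y - x) df.
rewrite /derive (cvg_lim _ fl) //.
apply: (cvgr_to_le (cvg_dnbhs_at_right fl)).
near=> h; have h0 : 0 < h by [].
have h1 : h <= 1 by near: h; exact: nbhs_right_le.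
rewrite /= -[_ *: _]/(h^-1 * _) ler_pdivrMl // mulrBr.
have -> : h *: (y - x) + x = h *: y + (1 - h) *: x.
  by rewrite scalerBr scalerBl scale1r addrA addrAC.
have := @convex_everywhereE f y x h cf; rewrite (ltW h0) h1 => /(_ isT).
lra.
Unshelve. all: by end_near. Qed.

(** A partial sum of a convex combination is normalised by the mass it has
    already collected, so that the induction stays inside [C]. *)
Lemma convex_set_sum C (s : seq V) (a : V -> R) : @convex_set R V C ->
  s != [::] -> (forall v, v \in s -> C v /\ 0 < a v) ->
  C ((\sum_(v <- s) a v)^-1 *: \sum_(v <- s) a v *: v).
Proof.
move=> cC; elim: s => // v [|u s] IHs _ Cs.
  have [Cv av] := Cs v (mem_head _ _).
  by rewrite !big_seq1 scalerA mulVf ?scale1r // gt_eqF.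
have [Cv av] := Cs v (mem_head _ _).
have {}IHs := IHs isT (fun w ws => Cs w (mem_behead (s := v :: u :: s) ws)).
rewrite [in X in C X]big_cons [X in C (_ *: X)]big_cons.
move: IHs; set b := \sum_(w <- u :: s) a w; set y := \sum_(w <- u :: s) _.
have b0 : 0 < b.
  rewrite /b big_cons ltr_wpDr //; last first.
    by have [] := Cs u; rewrite ?inE ?eqxx ?orbT.
  rewrite big_seq sumr_ge0 // => w ws; apply/ltW.
  by have [] := Cs w; rewrite // !inE ws !orbT.
move=> Cy; have ab0 : 0 < a v + b by rewrite addr_gt0.
have -> : (a v + b)^-1 *: (a v *: v + y)
    = (a v / (a v + b)) *: v + (1 - a v / (a v + b)) *: (b^-1 *: y).
  rewrite scalerDr !scalerA; congr (_ *: _ + _ *: _); first exact: mulrC.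
  by field; rewrite !gt_eqF.
apply: convex_setE => //.
by rewrite divr_ge0 ?(ltW av) ?(ltW ab0) //= ler_pdivrMr // mul1r lerDl ltW.
Qed.

(** By convexity, a value at [h] below the one at [e] would force the value at
    the intermediate point [b] below the one at [e] as well. *)
Lemma convex_ray_min f x d (e b h : R) : convex_everywhere f ->
  e < b -> b < h -> f (x + e *: d) <= f (x + b *: d) ->
  f (x + e *: d) <= f (x + h *: d).
Proof.
move=> cf eb bh fle; have eh : 0 < h - e by rewrite subr_gt0 (lt_trans eb).
pose t := (b - e) / (h - e).
have t0 : 0 < t by rewrite divr_gt0 // subr_gt0.
have t1 : t <= 1 by rewrite ler_pdivrMr // mul1r lerD2r ltW.
have := @convex_everywhereE f (x + h *: d) (x + e *: d) t cf.
rewrite (ltW t0) t1 => /(_ isT).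
have -> : t *: (x + h *: d) + (1 - t) *: (x + e *: d) = x + b *: d.
  rewrite !scalerDr addrACA -scalerDl subrKC scale1r !scalerA -scalerDl.
  by congr (_ + _ *: _); rewrite /t; field; rewrite gt_eqF.
move=> fb; rewrite -(ler_pM2l t0); lra.
Qed.

End convexity.

(** * The strong Wolfe gap *)

Section wolfe_gap.
Variables (R : realType) (n : nat) (C : set 'rV[R]_n) (f : 'rV[R]_n -> R).
Hypotheses (Ccompact : compact C) (Cconvex : @convex_set R 'rV[R]_n C).
Local Notation V := 'rV[R]_n.
Implicit Types (x y z : V) (S : {fset V}).

Lemma proper_support_sub x S v : proper_support C x S -> v \in S -> C v.
Proof. by move=> [a [extS _ _ _]] /extS []. Qed.

Lemma proper_support_neq0 x S : proper_support C x S -> exists v, v \in S.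
Proof.
move=> [a [_ _ a1 _]]; case: (fset_0Vmem S) => [S0|[v vS]]; last by exists v.
by move/esym/eqP: a1; rewrite S0 big_seq_fset0 oner_eq0.
Qed.

Lemma proper_support_mem x S : proper_support C x S -> C x.
Proof.
move=> supS; have [v vS] := proper_support_neq0 supS.
have [a [extS a0 a1 ->]] := supS.
have := @convex_set_sum _ _ C S a Cconvex; rewrite a1 invr1 scale1r; apply.
  by apply: contraTneq vS => S0; rewrite [_ \in S](_ : _ = (v \in enum_fset S)) // S0.
by move=> w wS; split; [exact: (proper_support_sub supS)|exact: a0].
Qed.

Lemma le_wolfe_gap x S y z : proper_support C x S -> y \in S -> C z ->
  dot (grad f x) (y - z) <= wolfe_gap C f x S.
Proof.
move=> supS yS Cz; have [M HM] := dot_bounded (grad f x) (compact_bounded Ccompact).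
apply: ub_le_sup; last by exists y, z.
exists (M + M) => _ [u [w [uS Cw ->]]]; rewrite dotBr.
have := HM _ Cw; have := HM _ (proper_support_sub supS uS).
by rewrite !ler_norml => /andP[_ ?] /andP[? _]; lra.
Qed.

Lemma wolfe_gap_le x S (b : R) : proper_support C x S ->
  (forall y z, y \in S -> C z -> dot (grad f x) (y - z) <= b) ->
  wolfe_gap C f x S <= b.
Proof.
move=> supS Hb; apply: ge_sup; last by move=> _ [u [w [uS Cw ->]]]; exact: Hb.
have [v vS] := proper_support_neq0 supS.
by exists (dot (grad f x) (v - v)), v, v; split=> //; exact: (proper_support_sub supS).
Qed.

(** As [x] is an average of [S], some vertex of [S] has slope at least that
    of [x]. *)
Lemma exists_slope_ge x S : proper_support C x S ->
  exists2 y, y \in S & dot (grad f x) x <= dot (grad f x) y.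
Proof.
move=> supS; have [a [_ a0 a1 xE]] := supS; set g := grad f x.
apply: contrapT => no_y.
have lty y : y \in S -> dot g y < dot g x.
  by move=> yS; rewrite ltNge; apply/negP => ?; apply: no_y; exists y.
have : \sum_(v <- S) a v * (dot g x - dot g v) = 0.
  under eq_bigr do rewrite mulrBr.
  by rewrite big_split /= -mulr_suml a1 mul1r sumrN -dot_sumr -xE subrr.
have [v vS] := proper_support_neq0 supS.
rewrite (big_fsetD1 v vS) /=; apply/eqP; rewrite gt_eqF // ltr_wpDr //.
  rewrite big_seq sumr_ge0 // => w; rewrite in_fsetD1 => /andP[_ wS].
  by rewrite mulr_ge0 ?(ltW (a0 _ wS)) // subr_ge0 ltW ?lty.
by rewrite mulr_gt0 ?a0 // subr_gt0 lty.
Qed.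

Lemma wolfe_gap_slope x S z : proper_support C x S -> C z ->
  dot (grad f x) (x - z) <= wolfe_gap C f x S.
Proof.
move=> supS Cz; have [y yS le_y] := exists_slope_ge supS.
by rewrite (le_trans _ (le_wolfe_gap supS yS Cz)) // !dotBr lerD2r.
Qed.

Lemma wolfe_gap_ge0 x S : proper_support C x S -> 0 <= wolfe_gap C f x S.
Proof.
move=> supS; have [v vS] := proper_support_neq0 supS.
have := le_wolfe_gap supS vS (proper_support_sub supS vS).
by rewrite dotBr subrr.
Qed.

Lemma min_wolfe_gap_le x S : proper_support C x S ->
  min_wolfe_gap C f x <= wolfe_gap C f x S.
Proof.
move=> supS; apply: ge_inf; last by exists S.
by exists 0 => _ [S' supS' <-]; exact: wolfe_gap_ge0.
Qed.

End wolfe_gap.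

(** * Minimizers and suboptimality *)

Section minimum.
Variables (R : realType) (n : nat) (C : set 'rV[R]_n) (f : 'rV[R]_n -> R).
Hypotheses (Ccompact : compact C) (C0 : C !=set0).
Hypotheses (fdiff : differentiable_everywhere f).
Local Notation V := 'rV[R]_n.
Implicit Types (x y z : V) (S : {fset V}).

Let fcont : continuous f.
Proof. by move=> x; exact: differentiable_continuous. Qed.

Lemma minimizers_nonempty : minimizers C f !=set0.
Proof.
have [|c cC cmin] := @EVT_min_rV R n f C C0 Ccompact.
  exact: continuous_subspaceT.
by exists c; split; [exact: set_mem|move=> b /mem_set; exact: cmin].
Qed.

Lemma min_valueE x : minimizers C f x -> min_value C f = f x.
Proof.
move=> [Cx xmin]; apply/eqP; rewrite eq_le; apply/andP; split.
  by apply: ge_inf; [exists (f x) => _ [y Cy <-]; exact: xmin|exists x].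
by apply: lb_le_inf; [exists (f x), x|move=> _ [y Cy <-]; exact: xmin].
Qed.

Lemma min_value_le x : C x -> min_value C f <= f x.
Proof.
move=> Cx; have [m mm] := minimizers_nonempty.
by rewrite (min_valueE mm); case: mm => _; exact.
Qed.

Lemma compact_minimizers : compact (minimizers C f).
Proof.
have [m mm] := minimizers_nonempty.
have -> : minimizers C f = C `&` f @^-1` [set y | y <= f m].
  apply/seteqP; split => [x [Cx xmin]|x [Cx /= fx]].
    by split=> //; apply: xmin; case: mm.
  by split=> // b Cb; apply: le_trans fx _; case: mm => _; exact.
apply: compact_closedI => //; apply: preimage_closed => [y _|].
  exact: fcont.
exact: closed_le.
Qed.

Lemma suboptimality_le_gap x S : convex_everywhere f ->
  proper_support C x S -> f x - min_value C f <= wolfe_gap C f x S.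
Proof.
move=> cf supS; have [m mm] := minimizers_nonempty.
have := @convex_grad_le _ _ f x m (fdiff x) cf.
have := wolfe_gap_slope f Ccompact supS mm.1.
rewrite (min_valueE mm) !dotBr; lra.
Qed.

End minimum.

(** * Scaling and the error bound *)

Section norms.
Variables (R : realType) (n : nat) (N : 'rV[R]_n -> R).
Hypothesis N_norm : is_norm N.
Local Notation V := 'rV[R]_n.
Implicit Types (x y : V).

Let N0 : N 0 = 0.
Proof. by case: N_norm => _ _ NZ _; rewrite -(scale0r 0) NZ normr0 mul0r. Qed.

Lemma norm_gt0 x : x != 0 -> 0 < N x.
Proof.
case: N_norm => Nge0 Neq0 _ _ x0; rewrite lt_neqAle Nge0 andbT eq_sym.
by apply: contra x0 => /eqP/Neq0 ->.
Qed.

Lemma norm_distC x y : N (x - y) = N (y - x).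
Proof.
by case: N_norm => _ _ NZ _; rewrite -opprB -scaleN1r NZ normrN1 mul1r.
Qed.

Lemma norm_le_supnorm x : N x <= (\sum_(i < n) N (delta_mx 0 i)) * `|x|.
Proof.
case: N_norm => Nge0 _ NZ ND; rewrite {1}(row_sum_delta x) mulr_suml.
suff Nsum (r : seq 'I_n) :
    N (\sum_(i <- r) x 0 i *: delta_mx 0 i) <= \sum_(i <- r) N (delta_mx 0 i) * `|x|.
  exact: Nsum.
elim: r => [|i r IHr]; first by rewrite !big_nil N0.
rewrite !big_cons (le_trans (ND _ _)) // lerD // NZ mulrC ler_wpM2l //.
exact: coord_le_supnorm.
Qed.

Lemma norm_dist_continuous (c : V) : continuous (fun y : V => N (c - y)).
Proof.
have [Nge0 _ _ ND] := N_norm.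
move=> x; apply/(@cvgrPdist_le _ _ _ (nbhs x) (nbhs_filter x)) => e e0.
set K := \sum_(i < n) N (delta_mx 0 i) + 1.
have K0 : 0 < K by rewrite ltr_wpDl // sumr_ge0.
apply/nbhs_ballP; exists (K^-1 * e) => [|y]; first by rewrite /= mulr_gt0 ?invr_gt0.
rewrite -ball_normE /= => xy.
have Nxy : N (x - y) <= e.
  rewrite (le_trans (norm_le_supnorm _)) //.
  rewrite (@le_trans _ _ (K * `|x - y|)) // ?ler_wpM2r ?lerDl //.
  by rewrite -ler_pdivlMl // ltW.
have tri (u v : V) : N (c - u) - N (c - v) <= N (v - u).
  by have := ND (v - u) (c - v); rewrite addrC addrA subrK -lerBlDr.
apply: le_trans Nxy; rewrite ler_norml lerNl opprB; apply/andP; split; first exact: tri.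
by rewrite (norm_distC x y); exact: tri.
Qed.

(** A compact set avoiding [x] stays at positive distance from it in any norm,
    so the normalised slopes form a bounded set, as a supremum over them
    requires. *)
Lemma normalized_slope_bounded (A : set V) (g x : V) : compact A -> ~ A x ->
  has_ubound [set dot g ((N (x - a))^-1 *: (x - a)) | a in A].
Proof.
move=> Acompact nAx.
have [A0|/set0P A0] := eqVneq A set0.
  by exists 0 => y [a]; rewrite A0.
have [|m mA mmin] := @EVT_min_rV R n (fun a => N (x - a)) A A0 Acompact.
  by apply: continuous_subspaceT; exact: norm_dist_continuous.
have Am := set_mem mA.
have m0 : 0 < N (x - m).
  by apply: norm_gt0; rewrite subr_eq0; apply: contra_notN nAx => /eqP ->.
have [M HM] := dot_bounded g (compact_bounded Acompact).
exists ((N (x - m))^-1 * (`|dot g x| + M)) => _ [a Aa <-].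
have le_m : N (x - m) <= N (x - a) by apply/mmin/mem_set.
have dM : dot g (x - a) <= `|dot g x| + M.
  rewrite dotBr lerD ?ler_norm //; have := HM _ Aa.
  by rewrite ler_norml => /andP[? _]; lra.
have M0 : 0 <= `|dot g x| + M by rewrite addr_ge0 ?(le_trans _ (HM _ Aa)).
rewrite dotZr (@le_trans _ _ ((N (x - a))^-1 * (`|dot g x| + M))) //.
  by rewrite ler_wpM2l // invr_ge0 (le_trans (ltW m0)).
by rewrite ler_wpM2r // lef_pV2 // posrE ?(lt_le_trans m0).
Qed.

End norms.

(** The exponent [1 / (1 - theta)] comes from solving
    [h <= (c / delta) * w * h `^ theta] for the suboptimality [h]. *)
Lemma suboptimality_le_gap_powR (R : realType) (n : nat) (N : 'rV[R]_n -> R)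
    (C : set 'rV[R]_n) (f : 'rV[R]_n -> R) (delta theta c : R)
    (x : 'rV[R]_n) (S : {fset 'rV[R]_n}) :
  is_norm N -> compact C -> @convex_set R 'rV[R]_n C ->
  0 < delta -> delta_scaling C N delta ->
  differentiable_everywhere f -> convex_everywhere f ->
  0 <= theta < 1 -> 0 < c -> holderian_error_bound C N f theta c ->
  proper_support C x S ->
  f x - min_value C f <= (c / delta * wolfe_gap C f x S) `^ (1 / (1 - theta)).
Proof.
move=> N_norm Ccompact Cconvex delta0 scal fdiff cf /andP[th0 th1] c0 heb supS.
set w := wolfe_gap _ _ _ _; set fm := min_value C f.
have Cx := proper_support_mem Cconvex supS.
have C0 : C !=set0 by exists x.
have [h0|h0] := leP (f x - fm) 0; first by rewrite (le_trans h0) ?powR_ge0.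
have nmin : ~ minimizers C f x.
  by move=> mx; move: h0; rewrite /fm (min_valueE mx) subrr ltxx.
have X0 := minimizers_nonempty Ccompact C0 fdiff.
have h_le a : minimizers C f a -> delta * (f x - fm) <= w * N (x - a).
  move=> ma.
  have Na0 : 0 < N (x - a).
    by apply: norm_gt0 => //; rewrite subr_eq0; apply: contra_notN nmin => /eqP ->.
  have := scal f fdiff cf x Cx nmin => /le_trans/(_ (min_wolfe_gap_le f Ccompact supS)).
  rewrite -/w => le_w.
  have ub := normalized_slope_bounded N_norm (grad f x)
    (compact_minimizers Ccompact C0 fdiff) nmin.
  have := ub_le_sup ub (imageP (fun a => dot (grad f x) ((N (x - a))^-1 *: (x - a))) ma).
  rewrite dotZr => le_sup.
  have := @convex_grad_le _ _ f x a (fdiff x) cf.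
  rewrite /fm (min_valueE ma) => le_f.
  have {le_w} := le_trans (ler_wpM2l (ltW delta0) le_sup) le_w.
  rewrite mulrCA ler_pdivrMl // => le_wN.
  rewrite mulrC [leRHS]mulrC; apply: le_trans le_wN; rewrite mulrC ler_pM2l //.
  by move: le_f; rewrite !dotBr; lra.
have w0 : 0 < w := lt_le_trans h0 (suboptimality_le_gap Ccompact C0 fdiff cf supS).
set h := f x - fm in h0 h_le *.
have dist_ge : delta * h / w <= inf [set N (x - a) | a in minimizers C f].
  apply: lb_le_inf; first by have [m mm] := X0; exists (N (x - m)), m.
  by move=> _ [a ma <-]; rewrite ler_pdivrMr // mulrC [leRHS]mulrC mulrC h_le.
have := le_trans dist_ge (heb x Cx); rewrite -/h => le_h.
have th1' : 0 < 1 - theta by lra.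
have hth : h `^ (1 - theta) <= c / delta * w.
  rewrite powRB ?(gt_eqF h0) ?implybT // powRr1 ?(ltW h0) //.
  rewrite ler_pdivrMr ?powR_gt0 //.
  have -> : c / delta * w * h `^ theta = c * h `^ theta * (w / delta).
    by field; rewrite gt_eqF.
  by rewrite -ler_pdivrMr ?divr_gt0 // invf_div mulrCA mulrA.
have -> : h = (h `^ (1 - theta)) `^ (1 / (1 - theta)).
  by rewrite -powRrM mulrC divfK ?gt_eqF // powRr1 ?ltW.
apply: ge0_ler_powR => //; rewrite ?nnegrE ?powR_ge0 //.
- by rewrite divr_ge0 // ltW.
- by rewrite mulr_ge0 ?divr_ge0 // ltW.
Qed.

(** * Updates of the convex decomposition *)

Section reweighting.
Variables (R : realType) (n : nat) (C : set 'rV[R]_n).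
Local Notation V := 'rV[R]_n.
Implicit Types (st : fw_state R n) (S : {fset V}) (u v : V).

Lemma sum_reweight st S v (a b : R) (W : lmodType R) (F : V -> W) :
  (support st `<=` S)%fset -> v \in S ->
  \sum_(u <- S) (a * cur_weight st u + b * (u == v)%:R) *: F u =
  a *: (\sum_(u <- support st) weight st u *: F u) + b *: F v.
Proof.
move=> subS vS.
under eq_bigr do rewrite scalerDl -!scalerA.
rewrite big_split /= -!scaler_sumr; congr (a *: _ + b *: _).
  rewrite -(big_fset_incl _ subS) => [|u _ uS]; last first.
    by rewrite /cur_weight (negbTE uS) scale0r.
  by rewrite big_seq [RHS]big_seq; apply: eq_bigr => u uS; rewrite /cur_weight uS.
rewrite (big_fsetD1 v vS) /= eqxx scale1r big_seq big1 ?addr0 // => u.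
by rewrite in_fsetD1 => /andP[/negbTE -> _]; rewrite scale0r.
Qed.

(** Every update of the algorithm is of this form: the old weights are scaled
    by [a], the weight of one vertex [v] is shifted by [b], and the vertices
    left with weight zero are discarded. *)
Lemma proper_decomposition_reweight st S v (a b : R) (w : V -> R) :
  proper_decomposition C (iterate st) (support st) (weight st) ->
  extreme_point C v -> a + b = 1 ->
  (forall u, w u = a * cur_weight st u + b * (u == v)%:R) ->
  (S `<=` v |` support st)%fset -> (forall u, u \in S -> 0 < w u) ->
  (forall u, u \in (v |` support st)%fset -> u \notin S -> w u = 0) ->
  proper_decomposition C (a *: iterate st + b *: v) S w.
Proof.
move=> [extS a0 a1 xE] extv ab1 wE subS wpos wzero.
have sum_w (W : lmodType R) (F : V -> W) : \sum_(u <- S) w u *: F u =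
    a *: (\sum_(u <- support st) weight st u *: F u) + b *: F v.
  rewrite -(@sum_reweight st (v |` support st)%fset) ?fsubsetUr ?fset1U1 //.
  rewrite (big_fset_incl _ subS) => [|u uU uS]; last by rewrite wzero ?scale0r.
  by apply: eq_bigr => u _; rewrite wE.
split=> //.
- move=> u /(fsubsetP subS); rewrite in_fset1U => /predU1P[-> //|]; exact: extS.
- have := sum_w R^o (fun=> 1).
  rewrite -[X in a *: X]/(\sum_(u <- support st) weight st u * 1).
  under eq_bigr do rewrite -[_ *: _]/(_ * 1) mulr1.
  move=> ->; under eq_bigr do rewrite mulr1.
  by rewrite a1 -[LHS]/(a * 1 + b * 1) !mulr1.
- by rewrite (sum_w _ id) -xE.
Qed.

Lemma cur_weight_gt0 st u :
  proper_decomposition C (iterate st) (support st) (weight st) ->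
  u \in support st -> 0 < cur_weight st u.
Proof. by move=> [_ a0 _ _] uS; rewrite /cur_weight uS a0. Qed.

Lemma cur_weight_ge0 st u :
  proper_decomposition C (iterate st) (support st) (weight st) ->
  0 <= cur_weight st u.
Proof.
move=> dec; case: (boolP (u \in support st)) => [/(cur_weight_gt0 dec)/ltW //|].
by rewrite /cur_weight => /negbTE ->.
Qed.

(** A vertex carrying the whole mass is the current point itself; away from it
    the step bound [alpha / (1 - alpha)] has a positive denominator. *)
Lemma cur_weight_lt1 st v :
  proper_decomposition C (iterate st) (support st) (weight st) ->
  v \in support st -> iterate st != v -> cur_weight st v < 1.
Proof.
move=> [_ a0 a1 xE] vS; rewrite /cur_weight vS; apply: contraNT.
rewrite -leNgt => v1.
have rest0 : \sum_(u <- (support st `\ v)%fset) weight st u <= 0.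
  by move: a1; rewrite (big_fsetD1 v vS) /= => a1; lra.
have noD u : u \notin (support st `\ v)%fset.
  apply: contraTN rest0 => uD; rewrite -ltNge (big_fsetD1 u uD) /= ltr_wpDr //.
    rewrite big_seq sumr_ge0 // => w; rewrite !in_fsetD1 => /and3P[_ _ wS].
    exact/ltW/a0.
  by apply: a0; move: uD; rewrite in_fsetD1 => /andP[].
have D0 : (support st `\ v)%fset = fset0.
  by apply/fsetP => u; rewrite (negbTE (noD u)) in_fset0.
move: a1 xE; rewrite !(big_fsetD1 v vS) /= D0 !big_seq_fset0 !addr0 => -> ->.
by rewrite scale1r.
Qed.

End reweighting.

(** * Progress of one step *)

(** The decrease of [f] that the curvature bound guarantees along a direction
    of slope [- h]: the minimum over [eta] of [CA * eta `^ s / s - eta * h] is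
    [- fw_progress s CA h], attained at [eta = (h / CA) `^ (1 / (s - 1))]. *)
Definition fw_progress (R : realType) (s CA h : R) : R :=
  (h / CA) `^ (1 / (s - 1)) * h * ((s - 1) / s).

Section step.
Variables (R : realType) (n : nat) (C : set 'rV[R]_n) (f : 'rV[R]_n -> R).
Variables (s CA : R).
Hypothesis Cconvex : @convex_set R 'rV[R]_n C.
Hypotheses (s1 : 1 < s) (fconvex : convex_everywhere f).
Hypothesis curvature : holder_away_curvature C f s = CA%:E.
Local Notation V := 'rV[R]_n.
Implicit Types (x u v : V) (st : fw_state R n).

Lemma fw_progress_gt0 (h : R) : 0 < h -> h <= CA -> 0 < fw_progress s CA h.
Proof.
move=> h0 hCA; have CA0 := lt_le_trans h0 hCA.
have s0 : 0 < s := lt_trans ltr01 s1; have s10 : 0 < s - 1 by rewrite subr_gt0.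
by apply: mulr_gt0; [apply: mulr_gt0; rewrite ?powR_gt0 ?divr_gt0|rewrite divr_gt0].
Qed.

Lemma curvature_le x u v (eta : R) : C x -> C u -> C v -> 0 < eta <= 1 ->
  f (x + eta *: (u - v)) <=
    f x + eta * dot (grad f x) (u - v) + CA * eta `^ s / s.
Proof.
move=> Cx Cu Cv eta01; have /andP[eta0 _] := eta01.
set q := s / eta `^ s *
  (f (x + eta *: (u - v)) - f x - eta * dot (grad f x) (u - v)).
have : (q%:E <= CA%:E)%E.
  by rewrite -curvature; apply: ereal_sup_ubound; exists x, u, v, eta.
have es0 : 0 < eta `^ s by rewrite powR_gt0.
have s0 : 0 < s := lt_trans ltr01 s1.
rewrite lee_fin /q mulrAC ler_pdivrMr // -ler_pdivlMl // [s^-1 * _]mulrC.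
by rewrite !lerBlDr [leRHS]addrC [_ + eta * _]addrC [leRHS]addrA.
Qed.

Lemma curvature_progress x u v (h : R) : C x -> C u -> C v ->
  0 < h -> h <= CA -> h <= - dot (grad f x) (u - v) ->
  exists2 eta, 0 < eta <= 1 &
    f (x + eta *: (u - v)) <= f x - fw_progress s CA h.
Proof.
move=> Cx Cu Cv h0 hCA slope; have CA0 := lt_le_trans h0 hCA.
have s10 : 0 < s - 1 by rewrite subr_gt0.
set eta := (h / CA) `^ (1 / (s - 1)).
have eta0 : 0 < eta by rewrite powR_gt0 ?divr_gt0.
have eta1 : eta <= 1.
  rewrite -(powRr0 (h / CA)) ger_powR ?divr_gt0 ?ler_pdivrMr ?mul1r //.
  by rewrite invr_ge0 ltW.
exists eta; first by rewrite eta0.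
have etas : CA * eta `^ s = eta * h.
  rewrite -(@mulr_powRB1 _ eta s) ?(ltW eta0) ?(lt_trans _ s1) //.
  rewrite -powRrM divfK ?gt_eqF // powRr1; last by rewrite divr_ge0 ?ltW.
  by field; rewrite gt_eqF.
have := @curvature_le x u v eta Cx Cu Cv; rewrite eta0 eta1 => /(_ isT)/le_trans.
apply; rewrite etas /fw_progress -/eta.
have -> : f x - eta * h * ((s - 1) / s) = f x + eta * - h + eta * h / s.
  by field; rewrite gt_eqF // (lt_trans _ s1).
by rewrite lerD2r lerD2l ler_pM2l // lerNr.
Qed.

(** One of the two slopes is thus at least half of the gap, which is why half of
    the threshold can decide between the two kinds of step. *)
Lemma le_gap_sum x (S : {fset V}) v u : proper_support C x S ->
  argmin C (dot (grad f x)) v ->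
  argmax [set w | w \in S] (dot (grad f x)) u ->
  wolfe_gap C f x S <= - dot (grad f x) (v - x) - dot (grad f x) (x - u).
Proof.
move=> supS [_ vmin] [_ umax]; apply: wolfe_gap_le => // y z yS Cz.
rewrite !dotBr; have := umax _ yS; have := vmin _ Cz; lra.
Qed.

(** A step that decreases [f] by [fw_progress] adds at most one vertex, and
    any other step is an away step that removes one; counting each removal
    against the addition that preceded it leaves one guaranteed decrease per
    two iterations, up to the net change of the support. *)
Lemma fafw_stepP (thr : R) st st' : 0 < thr -> thr / 2 <= CA ->
  proper_decomposition C (iterate st) (support st) (weight st) ->
  thr < gap C f st -> fafw_step C f thr st st' ->
  proper_decomposition C (iterate st') (support st') (weight st') /\
  fw_progress s CA (thr / 2) *
      (1 - (#|` support st|%:R - #|` support st'|%:R))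
    <= 2 * (f (iterate st) - f (iterate st')).
Proof.
move=> thr0 thrCA dec lt_gap [v [u [eta []]]] /=.
have h0 : 0 < thr / 2 by rewrite divr_gt0.
have P0 := fw_progress_gt0 h0 thrCA.
have supS : proper_support C (iterate st) (support st) by exists (weight st).
have Cx := proper_support_mem Cconvex supS.
move: P0 Cx; set P := fw_progress _ _ _; set x := iterate st => P0 Cx.
move=> extv vmin umax; case: ifP => [fw|/negbT]; last first.
  rewrite -leNgt => away [[/andP[eta0 eta_le] eta_min] ->] /=.
  have Su : u \in support st by case: umax.
  have extu : extreme_point C u by have [extS _ _ _] := dec; exact: extS.
  have Cu : C u by case: extu.
  have slope : thr / 2 < - dot (grad f x) (x - u).
    by have := le_gap_sum supS vmin umax; move: lt_gap; rewrite /gap -/x; lra.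
  have xu : x != u.
    by apply: contraTneq slope => ->; rewrite dotBr subrr oppr0 -leNgt ltW.
  have cu1 := cur_weight_lt1 dec Su xu; have cu0 := cur_weight_gt0 dec Su.
  set eta_max := cur_weight st u / _ in eta_le eta_min *.
  have eta1 : 0 < 1 + eta by rewrite ltr_pwDl.
  have cu1' : 0 < 1 - cur_weight st u by rewrite subr_gt0.
  have eta_max0 : 0 < eta_max by rewrite divr_gt0.
  split.
    have -> : x + eta *: (x - u) = (1 + eta) *: x + (- eta) *: u.
      by rewrite scalerBr scalerDl scale1r scaleNr addrA.
    apply: (proper_decomposition_reweight dec extu (a := 1 + eta)).
    - by rewrite addrK.
    - by move=> w; rewrite mulNr.
    - rewrite fsetUC fsubsetU //; case: ifP => _; rewrite ?fsubset_refl //.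
      by rewrite fsubD1set.
    - move=> w; case: ifPn => [_|eta_neq].
        rewrite in_fsetD1 => /andP[/negbTE -> wS].
        by rewrite mulr0 subr0 mulr_gt0 ?(cur_weight_gt0 dec).
      have {eta_neq} eta_lt : eta < eta_max by rewrite lt_neqAle eta_neq.
      case: eqVneq => [-> _|_ wS]; last first.
        by rewrite mulr0 subr0 mulr_gt0 ?(cur_weight_gt0 dec).
      by move: eta_lt; rewrite /eta_max ltr_pdivlMr // mulr1; lra.
    - move=> w; rewrite in_fset1U; case: ifPn => [/eqP eta_eq wU|_].
        rewrite in_fsetD1 negb_and negbK => wN; have {wU wN} -> : w = u.
          by apply/eqP; case/orP: wU wN => // ->; rewrite orbF.
        by rewrite eqxx mulr1 eta_eq /eta_max; field; rewrite gt_eqF.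
      by case: eqVneq => [->|_ /= ->]; rewrite ?Su.
  case: ifPn => [_|eta_neq].
    have -> : #|` support st| = #|` (support st `\ u)%fset|.+1 by rewrite (cardfsD1 u) Su.
    rewrite -natr1 [X in _ * X](_ : _ = 0); last by lra.
    rewrite mulr0 mulr_ge0 // subr_ge0.
    by have := eta_min 0; rewrite /= lexx (ltW eta_max0) scale0r addr0; exact.
  have eta_lt : eta < eta_max by rewrite lt_neqAle eta_neq.
  rewrite subrr subr0 mulr1.
  have [eta' /andP[eta'0 eta'1] le_eta'] :=
    curvature_progress Cx Cx Cu h0 thrCA (ltW slope).
  suff /le_trans/(_ le_eta') dec_f : f (x + eta *: (x - u)) <= f (x + eta' *: (x - u)).
    by move: P0; have : f (x + eta *: (x - u)) <= f x - P := dec_f; lra.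
  have [le_max|gt_max] := leP eta' eta_max.
    by apply: eta_min; rewrite /= (ltW eta'0).
  (* the line search stopped before the end of its interval, hence at a minimum
     of the whole ray, on which the curvature bound holds beyond [C] *)
  apply: (convex_ray_min fconvex eta_lt gt_max).
  by apply: eta_min; rewrite /= lexx ltW.
move=> [[/andP[eta0 eta1] eta_min] ->] /=.
have Cv : C v by case: extv.
have [eta' /andP[eta'0 eta'1] le_eta'] := curvature_progress Cx Cv Cx h0 thrCA (ltW fw).
have dec_f : f (x + eta *: (v - x)) <= f x - P.
  by apply: le_trans le_eta'; apply: eta_min; rewrite /= (ltW eta'0).
have {eta0} eta0 : 0 < eta.
  rewrite lt_neqAle eta0 andbT; apply: contraTneq dec_f => <-.
  by rewrite scale0r addr0 -ltNge ltrBlDr ltrDl.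
split.
  have -> : x + eta *: (v - x) = (1 - eta) *: x + eta *: v.
    by rewrite scalerBr scalerBl scale1r addrA addrAC.
  apply: (proper_decomposition_reweight dec extv (a := 1 - eta)) => //.
  - by rewrite subrK.
  - by case: ifP => // _; rewrite fsub1set fset1U1.
  - move=> w; case: ifPn => [/eqP ->|eta_n1].
      by rewrite in_fset1 => /eqP ->; rewrite eqxx subrr mul0r add0r mulr1.
    have eta_lt1 : 0 < 1 - eta by rewrite subr_gt0 lt_neqAle eta_n1.
    rewrite in_fset1U; case: eqVneq => [_ _|_ /= wS].
      by rewrite mulr1 ltr_wpDl // mulr_ge0 ?(ltW eta_lt1) ?(cur_weight_ge0 _ dec).
    by rewrite mulr0 addr0 mulr_gt0 ?(cur_weight_gt0 dec).
  - move=> w wU; case: ifPn => [/eqP ->|_]; last by rewrite wU.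
    by rewrite in_fset1 => /negbTE ->; rewrite subrr mul0r mulr0 addr0.
have card_le : #|` if eta == 1 then [fset v]%fset else (v |` support st)%fset|%:R
    <= #|` support st|%:R + 1 :> R.
  rewrite natr1 ler_nat; case: ifP => _; first by rewrite cardfs1.
  by rewrite cardfsU1; case: (_ \notin _); rewrite ?add1n ?add0n.
apply: (@le_trans _ _ (P * 2)); first by rewrite ler_pM2l //; lra.
lra.
Qed.

End step.

(** * Progress of a run *)

(** The net iteration count telescopes along the loop together with [f]. *)
Lemma fafw_loopP (R : realType) (n : nat) (C : set 'rV[R]_n)
    (f : 'rV[R]_n -> R) (s CA thr : R) (t : nat) (st st' : fw_state R n) :
  @convex_set R 'rV[R]_n C -> 1 < s -> convex_everywhere f ->
  holder_away_curvature C f s = CA%:E -> 0 < thr -> thr / 2 <= CA ->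
  proper_decomposition C (iterate st) (support st) (weight st) ->
  fafw_loop C f thr t st st' ->
  [/\ proper_decomposition C (iterate st') (support st') (weight st'),
      gap C f st' <= thr &
      fw_progress s CA (thr / 2) *
          (t%:R - (#|` support st|%:R - #|` support st'|%:R))
        <= 2 * (f (iterate st) - f (iterate st'))].
Proof.
move=> Cconvex s1 cf curv thr0 thrCA dec loop.
elim: loop dec => {t st st'} [st stop dec|t st st1 st2 lt_gap step _ IHloop dec].
  by split=> //; rewrite !subrr !mulr0.
have [dec1 le1] := fafw_stepP Cconvex s1 cf curv thr0 thrCA dec lt_gap step.
have [dec2 stop le2] := IHloop dec1; split=> //.
rewrite -natr1; move: le1 le2; lra.
Qed.

Lemma powRV (R : realType) (a r : R) : 0 <= a -> a^-1 `^ r = (a `^ r)^-1.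
Proof. by move=> a0; rewrite -powR_inv1 // -powRrM mulN1r powRN. Qed.

(** With [h = exp (- gamma) * w / 2], the number of guaranteed decreases of
    size [fw_progress s CA h] that fit in the initial suboptimality
    [(K * w) `^ r] scales as [w `^ (r - s / (s - 1))]. *)
Lemma fw_progress_ratio (R : realType) (s CA gamma K r w : R) :
  1 < s -> 0 < CA -> 0 <= K -> 0 < w ->
  fw_progress s CA (expR (- gamma) * w / 2) *
    (2 `^ (1 + s / (s - 1)) * (s / (s - 1)) * K `^ r * CA `^ (1 / (s - 1)) *
     expR (s / (s - 1) * gamma) * w `^ (- (s / (s - 1) - r)))
  = 2 * (K * w) `^ r.
Proof.
move=> s1 CA0 K0 w0.
have s0 : 0 < s := lt_trans ltr01 s1; have s10 : 0 < s - 1 by rewrite subr_gt0.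
set q := 1 / (s - 1); have pE : s / (s - 1) = 1 + q.
  by rewrite /q; field; rewrite gt_eqF.
rewrite pE /fw_progress -/q; set h := expR (- gamma) * w / 2.
have h0 : 0 < h by rewrite divr_gt0 ?mulr_gt0 ?expR_gt0.
have hp : (h / CA) `^ q * h = h `^ (1 + q) / CA `^ q.
  rewrite powRM ?invr_ge0 ?(ltW h0) ?(ltW CA0) // powRV ?(ltW CA0) //.
  rewrite powRD ?(gt_eqF h0) ?implybT // powRr1 ?(ltW h0) //.
  by rewrite mulrAC [h * _]mulrC.
have hE : h `^ (1 + q) =
    (expR ((1 + q) * gamma))^-1 * w `^ (1 + q) / 2 `^ (1 + q).
  rewrite /h !powRM ?mulr_ge0 ?invr_ge0 ?expR_ge0 ?(ltW w0) //.
  by rewrite powRV // -expRM mulNr expRN [gamma * _]mulrC.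
rewrite hp hE opprB powRB ?(gt_eqF w0) ?implybT //.
rewrite [2 `^ (1 + (1 + q))]powRD ?pnatr_eq0 ?implybT // powRr1 // powRM ?(ltW w0) //.
by rewrite -pE; field; rewrite !gt_eqF ?powR_gt0 ?expR_gt0.
Qed.

(** * Restarts *)

(** When [w] shrinks to [w'] by the factor [exp (- gamma)], the quantity
    [w `^ (- tau)] grows at least by the factor [exp (gamma * tau)]; a count [t]
    bounded by [D * w `^ (- tau)] is thus bounded by its increase. *)
Lemma count_le_powR_increase (R : realType) (gamma tau D w w' t : R) :
  0 < gamma -> 0 < tau -> 0 < D -> 0 < w -> 0 < w' ->
  w' <= expR (- gamma) * w -> t <= D * w `^ (- tau) ->
  t * ((expR (gamma * tau) - 1) / D) <= w' `^ (- tau) - w `^ (- tau).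
Proof.
move=> gamma0 tau0 D0 w0 w'0 le_w' le_t.
have e0 : 0 < expR (gamma * tau) - 1 by rewrite subr_gt0 -expR0 ltr_expR mulr_gt0.
apply: le_trans (ler_wpM2r (ltW (divr_gt0 e0 D0)) le_t) _.
have -> : D * w `^ (- tau) * ((expR (gamma * tau) - 1) / D)
    = expR (gamma * tau) * w `^ (- tau) - w `^ (- tau) by field; rewrite gt_eqF.
rewrite lerD2r.
have -> : expR (gamma * tau) * w `^ (- tau) = (expR (- gamma) * w) `^ (- tau).
  by rewrite powRM ?expR_ge0 ?(ltW w0) // -expRM mulrNN.
rewrite !powRN lef_pV2 ?posrE ?powR_gt0 ?mulr_gt0 ?expR_gt0 //.
by apply: ge0_ler_powR;
  rewrite ?nnegrE ?(ltW tau0) ?(ltW w'0) ?mulr_ge0 ?expR_ge0 ?(ltW w0).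
Qed.

Lemma net_count_telescope (R : realType) (T t m0 m1 m2 A a0 a1 a2 : R) :
  (T - (m0 - m1)) * A <= a1 - a0 -> (t - (m1 - m2)) * A <= a2 - a1 ->
  (T + t - (m0 - m2)) * A <= a2 - a0.
Proof. lra. Qed.

Section restart.
Variables (R : realType) (n : nat) (N : 'rV[R]_n -> R) (C : set 'rV[R]_n).
Variables (f : 'rV[R]_n -> R) (s CA delta theta c gamma : R).
Hypotheses (N_norm : is_norm N) (Ccompact : compact C).
Hypothesis Cconvex : @convex_set R 'rV[R]_n C.
Hypotheses (delta0 : 0 < delta) (scaling : delta_scaling C N delta).
Hypotheses (s1 : 1 < s) (fdiff : differentiable_everywhere f).
Hypotheses (fconvex : convex_everywhere f).
Hypothesis curvature : holder_away_curvature C f s = CA%:E.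
Hypotheses (theta01 : 0 <= theta < 1) (c0 : 0 < c).
Hypothesis error_bound : holderian_error_bound C N f theta c.
Hypothesis gamma0 : 0 < gamma.

Let r := 1 / (1 - theta).
Let tau := s / (s - 1) - r.
(** [D * w `^ (- tau)] bounds the corrected length of a run of initial gap [w]. *)
Let D := 2 `^ (1 + s / (s - 1)) * (s / (s - 1)) * (c / delta) `^ r *
         CA `^ (1 / (s - 1)) * expR (s / (s - 1) * gamma).
Hypothesis tau0 : 0 < tau.

Implicit Types st : fw_state R n.

Lemma restart_constant_gt0 : 0 < CA -> 0 < D.
Proof.
move=> CA0; have s0 : 0 < s := lt_trans ltr01 s1.
have s10 : 0 < s - 1 by rewrite subr_gt0.
by rewrite /D !mulr_gt0 ?powR_gt0 ?expR_gt0 ?divr_gt0 ?invr_gt0.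
Qed.

(** The guaranteed decreases of a run add up to at most the suboptimality at its
    start, which scaling and the error bound control by the gap. *)
Lemma fafw_count (t : nat) st st' : 0 < gap C f st ->
  expR (- gamma) * gap C f st / 2 <= CA ->
  proper_decomposition C (iterate st) (support st) (weight st) ->
  fafw C f gamma t st st' ->
  [/\ proper_decomposition C (iterate st') (support st') (weight st'),
      gap C f st' <= expR (- gamma) * gap C f st &
      t%:R - (#|` support st|%:R - #|` support st'|%:R)
        <= D * gap C f st `^ (- tau)].
Proof.
move=> w0 wCA dec run; set w := gap C f st in w0 wCA *.
have h0 : 0 < expR (- gamma) * w by rewrite mulr_gt0 ?expR_gt0.
have h20 : 0 < expR (- gamma) * w / 2 by rewrite divr_gt0.
have CA0 := lt_le_trans h20 wCA.
have [dec' stop le_sum] := fafw_loopP Cconvex s1 fconvex curvature h0 wCA dec run.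
split=> //; have P0 := fw_progress_gt0 s1 h20 wCA.
rewrite -(ler_pM2l P0) /D fw_progress_ratio ?divr_ge0 ?(ltW c0) ?(ltW delta0) //.
apply: le_trans le_sum _; rewrite ler_pM2l //.
have supS : proper_support C (iterate st) (support st) by exists (weight st).
have Cx' : C (iterate st').
  by apply: (@proper_support_mem _ _ C Cconvex _ (support st')); exists (weight st').
apply: le_trans (suboptimality_le_gap_powR N_norm Ccompact Cconvex delta0 scaling
  fdiff fconvex theta01 c0 error_bound supS).
by rewrite lerD2l lerN2 min_value_le //; exists (iterate st').
Qed.

(** Since a run shrinks the gap by [exp (- gamma)], its iteration count is also
    bounded by the increase of [w `^ (- tau)] over it; in that form the bounds of
    successive runs telescope. *)
Lemma restart_runsP (eps : R) (budget k T : nat) st0 st : 0 < eps ->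
  expR (- gamma) * gap C f st0 / 2 <= CA ->
  proper_decomposition C (iterate st0) (support st0) (weight st0) ->
  restart_runs C f eps budget (fun=> gamma) st0 k T st ->
  [/\ proper_decomposition C (iterate st) (support st) (weight st),
      gap C f st <= gap C f st0 &
      0 < gap C f st ->
      (T%:R - (#|` support st0|%:R - #|` support st|%:R)) *
          ((expR (gamma * tau) - 1) / D)
        <= gap C f st `^ (- tau) - gap C f st0 `^ (- tau)].
Proof.
move=> eps0 wCA dec0 runs.
elim: k T st / runs => [|k T t st st' _ [dec le_w0 le_T] lt_eps _ run].
  by split=> // _; rewrite !subrr mul0r.
have w0 : 0 < gap C f st := lt_trans eps0 lt_eps.
have wCA' : expR (- gamma) * gap C f st / 2 <= CA.
  have half0 : 0 <= 2^-1 :> R by rewrite invr_ge0.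
  exact: le_trans (ler_wpM2r half0 (ler_wpM2l (expR_ge0 _) le_w0)) wCA.
have CA0 : 0 < CA by apply: lt_le_trans wCA'; rewrite divr_gt0 ?mulr_gt0 ?expR_gt0.
have D0 := restart_constant_gt0 CA0.
have [dec' le_w' le_t] := fafw_count w0 wCA' dec run.
split=> [||w'0]; first exact: dec'.
  apply: le_trans le_w' (le_trans _ le_w0).
  by rewrite ger_pMl // -expR0 ler_expR oppr_le0 ltW.
rewrite natrD; apply: net_count_telescope (le_T w0) _.
exact: (count_le_powR_increase gamma0 tau0 D0 w0 w'0 le_w' le_t).
Qed.

End restart.

(** * The rate *)

(** Solving [w0 `^ (- tau) * B <= w `^ (- tau)] for [w]. *)
Lemma le_powR_inv (R : realType) (tau w w0 B : R) :
  0 < tau -> 0 < w -> 0 < w0 -> 0 < B ->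
  w0 `^ (- tau) * B <= w `^ (- tau) -> w <= w0 * (1 / B `^ (1 / tau)).
Proof.
move=> tau0 w_gt0 w00 B0 le_w.
have root (a : R) : 0 < a -> (a `^ tau) `^ (1 / tau) = a.
  by move=> a0; rewrite -powRrM mul1r mulfV ?gt_eqF // powRr1 ?ltW.
have le_pow : w `^ tau <= w0 `^ tau / B.
  rewrite ler_pdivlMr // mulrC; move: le_w.
  by rewrite !powRN ler_pdivrMl ?powR_gt0 // ler_pdivlMr ?powR_gt0.
have it0 : 0 <= 1 / tau by rewrite divr_ge0 ?ltW.
have := fun p q => ge0_ler_powR it0 p q le_pow.
rewrite !nnegrE ?powR_ge0 ?divr_ge0 ?powR_ge0 ?(ltW B0) // => /(_ isT isT).
by rewrite root // powRM ?powR_ge0 ?invr_ge0 ?(ltW B0) // root //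
  powRV ?(ltW B0) // [1 / B `^ _]div1r.
Qed.

Theorem theorem6p2 (R : realType) (n : nat)
    (N : 'rV[R]_n -> R) (C : set 'rV[R]_n) (f : 'rV[R]_n -> R)
    (delta s L theta c CA gamma eps : R) (budget : nat)
    (st0 stT : fw_state R n) (T : nat)
    (hN : is_norm N)
    (hCcompact : compact C) (hCconvex : @convex_set R 'rV[R]_n C)
    (hCdim : full_dimensional C)
    (hdelta : 0 < delta) (hscaling : delta_scaling C N delta)
    (hs : 1 < s <= 2)
    (hfconvex : convex_everywhere f) (hfsmooth : holder_smooth C f L s)
    (hCA : holder_away_curvature C f s = CA%:E)
    (htheta : 0 <= theta <= 1 / 2) (hc : 0 < c)
    (hheb : holderian_error_bound C N f theta c)
    (hgamma : 0 < gamma)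
    (hx0 : proper_decomposition C (iterate st0) (support st0) (weight st0))
    (hinit : expR (- gamma) * gap C f st0 / 2 <= CA)
    (heps : 0 < eps)
    (hrun : restart_output C f eps budget (fun=> gamma) st0 T stT) :
  let r := 1 / (1 - theta) in
  let w0 := gap C f st0 in
  let Ttilde : R :=
    T%:R - (#|` support st0 |%:R - #|` support stT |%:R) in
  let tau := s / (s - 1) - r in
  let Cs := 2 `^ (1 + s / (s - 1)) * (s / (s - 1)) * (c / delta) `^ r *
            CA `^ (1 / (s - 1)) in
  let Cgamma := (expR (gamma * tau) - 1) /
                (Cs * expR (s / (s - 1) * gamma) * w0 `^ (- tau)) in
  1 <= r -> r < s / (s - 1) ->
  (* the right-hand side is a real number only for a positive base *)
  0 < 1 + Ttilde * Cgamma ->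
  f (iterate stT) - min_value C f
    <= w0 * (1 / (1 + Ttilde * Cgamma) `^ (1 / tau)).
Proof.
move=> r w0 Ttilde tau Cs Cgamma r1 rs base0.
have [th0 th12] := andP htheta.
have theta01 : 0 <= theta < 1 by rewrite th0; lra.
have [s1 _] := andP hs.
have tau0 : 0 < tau by rewrite subr_gt0.
have [fdiff _] := hfsmooth.
have [[k runs] _] := hrun.
have [decT _ count] := restart_runsP hN hCcompact hCconvex hdelta hscaling s1
  fdiff hfconvex hCA theta01 hc hheb hgamma tau0 heps hinit hx0 runs.
have supT : proper_support C (iterate stT) (support stT) by exists (weight stT).
have sup0 : proper_support C (iterate st0) (support st0) by exists (weight st0).
have CxT := proper_support_mem hCconvex supT.
have C0 : C !=set0 by exists (iterate stT).
apply: le_trans (suboptimality_le_gap hCcompact C0 fdiff hfconvex supT) _.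
have w0_ge0 : 0 <= w0 := wolfe_gap_ge0 f hCcompact sup0.
rewrite -/(gap C f stT); have [wT0|wT_gt0] := leP (gap C f stT) 0.
  by rewrite (le_trans wT0) // mulr_ge0 ?divr_ge0 ?powR_ge0.
have w0_gt0 : 0 < w0.
  have [_ le_w0 _] := restart_runsP hN hCcompact hCconvex hdelta hscaling s1
    fdiff hfconvex hCA theta01 hc hheb hgamma tau0 heps hinit hx0 runs.
  exact: lt_le_trans le_w0.
apply: le_powR_inv => //.
have -> : w0 `^ (- tau) * (1 + Ttilde * Cgamma) = w0 `^ (- tau) +
    Ttilde * ((expR (gamma * tau) - 1) / (Cs * expR (s / (s - 1) * gamma))).
  rewrite /Cgamma mulrDr mulr1 invfM; congr (_ + _).
  rewrite [_ * (_ / w0 `^ (- tau))]mulrA mulrCA [w0 `^ _ * _]mulrC.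
  by rewrite -[_ / w0 `^ _ * _]mulrA mulVf ?mulr1 // gt_eqF ?powR_gt0.
by rewrite -lerBrDl; exact: count.
Qed.
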